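(* Let $D$ be a strong digraph with $n\geq 2$ vertices. If $d(u)+d(v)\geq \frac{5}{2}n-\frac{11}{2}$ for every pair $\{u,v\}$ of nonadjacent vertices of $D$ that is dominated or dominating, then $D$ is supereulerian.
   Context: All digraphs are finite, loopless and without parallel arcs (a pair of opposite arcs $(x,y),(y,x)$ is allowed). $(w,z)$ denotes an arc from $w$ to $z$. For a vertex $x$, $d(x)=d^-(x)+d^+(x)$ is the sum of its in-degree and out-degree. Two distinct vertices $u,v$ are nonadjacent if neither $(u,v)$ nor $(v,u)$ is an arc. A pair $\{u,v\}$ is dominated if there is a vertex $w$ with $(w,u),(w,v)\in A(D)$, and dominating if there is a vertex $w$ with $(u,w),(v,w)\in A(D)$. A digraph is strong if every vertex is reachable from every other vertex by a directed path. A digraph is supereulerian if it contains a closed directed trail (a closed walk with no repeated arcs) passing through every vertex, i.e. it has a spanning eulerian subdigraph. *)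

(* Defs.v *)
From mathcomp Require Import all_boot all_order all_algebra.

Set Implicit Arguments.
Unset Strict Implicit.
Unset Printing Implicit Defensive.

(* A finite digraph without parallel arcs is its arc relation [e : rel T] on a
   finite vertex type: [e x y] means that (x, y) is an arc, and opposite arcs
   are allowed. Looplessness is the hypothesis [irreflexive e]. *)
Section Digraph.

Variables (T : finType) (e : rel T).

Definition indeg (x : T) : nat := #|[set y | e y x]|.

Definition outdeg (x : T) : nat := #|[set y | e x y]|.

Definition deg (x : T) : nat := indeg x + outdeg x.

Definition nonadjacent (u v : T) : bool := [&& u != v, ~~ e u v & ~~ e v u].

Definition dominated (u v : T) : bool := [exists w, e w u && e w v].

Definition dominating (u v : T) : bool := [exists w, e u w && e v w].

Definition strong : Prop := forall x y : T, connect e x y.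

(* The successive arcs of the walk x :: p; [zip] drops the last vertex. *)
Definition walk_arcs (x : T) (p : seq T) : seq (T * T) := zip (x :: p) p.

(* The final vertex of p is x again. The empty p is the trivial trail at x. *)
Definition closed_trail (x : T) (p : seq T) : bool :=
  [&& path e x p, last x p == x & uniq (walk_arcs x p)].

Definition supereulerian : Prop :=
  exists (x : T) (p : seq T),
    closed_trail x p /\ forall v : T, v \in x :: p.

End Digraph.

(* Main.v *)
Require Import Defs.
From mathcomp Require Import all_boot all_order all_algebra zify lra.
Import Order.TTheory GRing.Theory Num.Theory.

(* Take a closed trail with vertex set V and arc set F, V of maximum size, and
   suppose r lies outside V. In the digraph h of the arcs not in F let A be the
   set reached from r and B the set reaching r. By maximality no h-cycle meets
   both V and its complement, so A and B meet outside V only, and no arc of F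
   goes from B to A. A segment of the trail leading from B to A may be exchanged
   for an h-path through a new vertex; maximality means that the vertices lost
   this way cannot all be hooked up again by 2-cycles.
   The trail has an arc (b, p) where b has an arc to some c in A \cap B and p is
   nonadjacent to A \cap B. Then {p, c} is dominated. Every arc from A to p is in
   F, and the exchange on the trail piece ending with that arc yields a vertex
   outside A and B, private to the piece, that forms no 2-cycle with p. Counting
   gives 2(|A| + t) <= n + 3, t being the number of nonneighbours of c outside
   A \cap B; and t <= 2 is impossible because the interior of an exchanged
   segment could be hooked up again.
   Take a path with interior outside V that joins two vertices of V. The bound
   holds for A and t at its first inner vertex and, reversing all arcs, for the
   set B' reaching its last inner vertex and the corresponding t'. A and B' meet,
   and the vertices outside both are counted in t', so |A| + |B'| > n - t'; adding
   the two bounds gives t <= 2. *)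

Set Implicit Arguments.
Unset Strict Implicit.
Unset Printing Implicit Defensive.

(** * Splitting sequences *)

Section Walks.

Variable T : eqType.
Implicit Types (x y u v : T) (p q s : seq T).

Lemma split_last_has (P : pred T) s : has P s ->
  exists s1 y s2, [/\ s = s1 ++ y :: s2, P y & ~~ has P s2].
Proof.
elim/last_ind: s => // s y IH; rewrite has_rcons.
case Py: (P y) => /=; first by exists s, y, [::]; rewrite -cats1.
case/IH=> s1 [z] [s2 [-> Pz nPs2]]; exists s1, z, (rcons s2 y).
by rewrite rcons_cat has_rcons Py.
Qed.

Lemma split_first_has (P : pred T) s : has P s ->
  exists s1 y s2, [/\ s = s1 ++ y :: s2, P y & ~~ has P s1].
Proof.
elim: s => // x s IH /=.
case Px: (P x) => /=; first by exists [::], x, s.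
case/IH=> s1 [z] [s2 [-> Pz nPs1]]; exists (x :: s1), z, s2.
by rewrite /= Px.
Qed.

Lemma split_last_visit x s : exists s1 s2,
  [/\ s = s1 ++ s2, last x s1 = x & x \notin s2].
Proof.
case: (boolP (x \in s)) => [xs|]; last by exists [::], s.
have /split_last_has[s1 [y [s2 [-> /eqP-> ns2]]]] : has (pred1 x) s by rewrite has_pred1.
exists (rcons s1 x), s2; rewrite cat_rcons last_rcons; split=> //.
by rewrite -has_pred1.
Qed.

(* The element just before the first x following the first z of s. *)
Definition next_pred x s z :=
  let s' := drop (index z s) s in last x (take (index x s') s').

(** As [x] is absent from [s2], the block [s2 ++ [:: a; x]] runs up to the next visit to [x]. Any
    [z] first met in such a block thus identifies it by its last arc. *)
Lemma next_predE x s1 s2 a s3 z : z \notin s1 -> z \in s2 -> x \notin s2 -> x != a ->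
  next_pred x (s1 ++ s2 ++ a :: x :: s3) z = a.
Proof.
move=> zs1 zs2; have /split_first_has[s4 [y [s5 [-> /eqP-> zs4]]]] : has (pred1 z) s2.
  by rewrite has_pred1.
rewrite mem_cat inE !negb_or has_pred1 in zs4 * => /and3P[_ xz xs5] xa.
have -> : s1 ++ (s4 ++ z :: s5) ++ a :: x :: s3 = (s1 ++ s4) ++ rcons (z :: s5) a ++ x :: s3.
  by rewrite -!catA /= cat_rcons.
have zs14 : z \notin s1 ++ s4 by rewrite mem_cat negb_or zs1.
have xz5a : x \notin rcons (z :: s5) a by rewrite mem_rcons !inE !negb_or xa xz.
rewrite /next_pred [index z _]index_cat (negbTE zs14) /= eqxx addn0 drop_size_cat //.
by rewrite -cat_cons -rcons_cons index_cat (negbTE xz5a) /= eqxx addn0 take_size_cat // last_rcons.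
Qed.

End Walks.

(** * Arcs of walks and tours *)

Section Arcs.

Variable T : finType.
Implicit Types (x y u v : T) (p q s : seq T) (F : seq (T * T)) (e : rel T).

Lemma walk_arcs_cat x p q :
  walk_arcs x (p ++ q) = walk_arcs x p ++ walk_arcs (last x p) q.
Proof. by elim: p x => //= y p IH x; rewrite /walk_arcs /= -/(walk_arcs _ _) IH. Qed.

Lemma walk_arcs_cons x y p : walk_arcs x (y :: p) = (x, y) :: walk_arcs y p.
Proof. by []. Qed.

Lemma unzip2_walk_arcs x p : unzip2 (walk_arcs x p) = p.
Proof. by elim: p x => //= y p IH x; rewrite IH. Qed.

Lemma unzip1_walk_arcs x p : unzip1 (walk_arcs x p) = belast x p.
Proof. by elim: p x => //= y p IH x; rewrite IH. Qed.

Arguments walk_arcs {T} x p : simpl never.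

Lemma walk_arcs_head x p u v : (u, v) \in walk_arcs x p -> v \in p.
Proof. by move=> /(map_f snd) /=; rewrite [map _ _]unzip2_walk_arcs. Qed.

Lemma walk_arcs_tail x p u v : (u, v) \in walk_arcs x p -> u \in x :: p.
Proof. by move=> /(map_f fst) /=; rewrite [map _ _]unzip1_walk_arcs; apply: mem_belast. Qed.

Lemma walk_arcs_uniq x p : uniq p -> uniq (walk_arcs x p).
Proof. by move=> up; apply: (@map_uniq _ _ snd); rewrite [map _ _]unzip2_walk_arcs. Qed.

Lemma walk_arcs_split x p u v : (u, v) \in walk_arcs x p ->
  exists p1 p2, p = p1 ++ v :: p2 /\ last x p1 = u.
Proof.
elim: p x => //= y p IH x; rewrite walk_arcs_cons inE => /orP[/eqP[-> ->]|/IH].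
  by exists [::], p.
by case=> p1 [p2 [-> <-]]; exists (y :: p1), p2.
Qed.

Lemma path_walk_arcs e x p : path e x p = all (fun a => e a.1 a.2) (walk_arcs x p).
Proof. by elim: p x => //= y p IH x; rewrite IH. Qed.

(* Tours list the arcs of F in a cyclic order that may differ from the one of
   the trail defining F. *)
Definition tour e F x s := [&& path e x s, last x s == x & perm_eq (walk_arcs x s) F].

Lemma closed_trail_tour e x s : closed_trail e x s -> tour e (walk_arcs x s) x s.
Proof. by case/and3P=> ? ? _; apply/and3P; split. Qed.

Lemma tour_closed_trail e F x s : uniq F -> tour e F x s -> closed_trail e x s.
Proof. by move=> uF /and3P[pxs lx /perm_uniq uFs]; apply/and3P; rewrite uFs. Qed.

Lemma tour_rot e F x p q : tour e F x (p ++ q) -> tour e F (last x p) (q ++ p).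
Proof.
case/and3P; rewrite cat_path last_cat walk_arcs_cat => /andP[pp pq] /eqP lq F_eq.
by apply/and3P; rewrite cat_path last_cat walk_arcs_cat lq pp pq perm_catC.
Qed.

Lemma tour_at e F x s y : y \in x :: s -> tour e F x s -> exists s', tour e F y s'.
Proof.
rewrite inE => /predU1P[->|]; first by exists s.
case/splitPr=> s1 s2; rewrite -cat_rcons => /tour_rot; rewrite last_rcons.
by exists (s2 ++ rcons s1 y).
Qed.

Lemma tour_arc e F x s u v : (u, v) \in F -> tour e F x s -> exists s', tour e F u (v :: s').
Proof.
move=> uvF t; case/and3P: (t) => _ _ /perm_mem F_eq.
move: uvF; rewrite -F_eq => /walk_arcs_split[p1 [p2 [s_eq lu]]].
move: t; rewrite s_eq => /tour_rot; rewrite lu; by exists (p2 ++ p1).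
Qed.

Lemma tour_perm e F x s y s' : tour e F x s -> tour e F y s' -> perm_eq s s'.
Proof.
case/and3P=> _ _ F1 /and3P[_ _ F2].
rewrite -(unzip2_walk_arcs x s) -(unzip2_walk_arcs y s').
by apply: perm_map; rewrite (perm_trans F1) // perm_sym.
Qed.

Lemma tour_mem e F x s y s' : tour e F x s -> tour e F y s' -> y \in x :: s ->
  x :: s =i y :: s'.
Proof.
have last_in z (r : seq T) v : tour e F z (v :: r) -> z \in v :: r.
  by case/and3P=> _ /eqP lz _; have := mem_last v r; rewrite -[last v r]/(last z (v :: r)) lz.
move=> t t' ys v; have ss' := tour_perm t t'.
case: s s' t t' ys ss' => [|a s] [|b s'] t t' ys /=.
- by move: ys; rewrite inE => /eqP->.
- by move/perm_size.
- by move/perm_size.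
move/perm_mem=> ss'; rewrite [LHS]in_cons [RHS]in_cons ss'.
have xs := last_in _ _ _ t; have ys' := last_in _ _ _ t'.
rewrite ss' in xs.
by apply/orP/orP => -[/eqP->|->]; rewrite ?xs ?ys'; right.
Qed.

(** Serves to make a chosen closed piece at a vertex directly follow a chosen arc. *)
Lemma tour_swap e F x p q w : last x p = x -> last x q = x ->
  tour e F x (p ++ q ++ w) -> tour e F x (q ++ p ++ w).
Proof.
move=> lp lq /and3P[]; rewrite !cat_path !last_cat !walk_arcs_cat !lp !lq.
case/and3P=> pp pq pw lw F_eq; apply/and3P.
by rewrite !cat_path !last_cat !walk_arcs_cat !(lp, lq) pp pq pw lw perm_catCA.
Qed.

Lemma closed_trail_cat e x s c : closed_trail e x s -> closed_trail e x c ->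
  ~~ has [in walk_arcs x s] (walk_arcs x c) -> closed_trail e x (s ++ c).
Proof.
case/and3P=> ps /eqP ls us /and3P[pc lc uc] dis; apply/and3P.
by rewrite cat_path last_cat walk_arcs_cat ls ps cat_uniq us uc dis.
Qed.

End Arcs.

(** * Vertex sets covered by a closed trail *)

Section Cover.

Variables (T : finType) (e : rel T).
Implicit Types (Q : {set T}).

Definition coverable Q := exists x s, closed_trail e x s /\ {subset Q <= x :: s}.

(** If the trail misses [z], it is rotated to start at [w] and continued by [z], [w]; the two added
    arcs are new because they meet [z]. *)
Lemma coverable_digon Q w z : e w z -> e z w -> w \in Q ->
  coverable Q -> coverable (z |: Q).
Proof.
move=> ewz ezw wQ [x [s [cs Qs]]].
have [zs|nzs] := boolP (z \in x :: s).
  by exists x, s; split=> // v; rewrite !inE => /predU1P[->//|/Qs].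
have uF : uniq (walk_arcs x s) by case/and3P: cs.
have t := closed_trail_tour cs; have [s' t'] := tour_at (Qs _ wQ) t.
have ss' := perm_mem (tour_perm t t').
have cs' := tour_closed_trail uF t'.
have nzs' : z \notin s' by rewrite -ss'; apply: contra nzs; rewrite inE orbC => ->.
have wz : z != w by apply: contraNneq nzs => ->; exact: Qs.
exists w, (s' ++ [:: z; w]); split.
  apply: closed_trail_cat => //.
    by rewrite /closed_trail /= ewz ezw eqxx inE xpair_eqE eq_sym (negbTE wz).
  rewrite /= orbF; apply/norP; split; apply/negP.
    by move/walk_arcs_head; apply/negP.
  by move/walk_arcs_tail; rewrite inE (negbTE wz) (negbTE nzs').
move=> v; rewrite !inE mem_cat !inE => /predU1P[->|/Qs]; first by rewrite eqxx !orbT.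
by rewrite (tour_mem t t' (Qs _ wQ)) inE => /orP[]->; rewrite ?orbT.
Qed.

End Cover.

(** * Degrees as sums over vertices *)

Section Degree.

Variables (T : finType) (e : rel T).

Lemma card_sum_mem (S : {set T}) : #|S| = \sum_u (u \in S).
Proof. by rewrite -sum1_card big_mkcond; apply: eq_bigr => u _; case: (u \in S). Qed.

Lemma deg_sum v : deg e v = \sum_u (e u v + e v u).
Proof.
by rewrite big_split /deg /indeg /outdeg !card_sum_mem; congr (_ + _);
   apply: eq_bigr => u _; rewrite inE.
Qed.

Lemma card_le2_mem (S : {set T}) x y v : #|S| <= 2 -> x \in S -> y \in S -> x != y ->
  v \in S -> v \in [set x; y].
Proof.
move=> S2 xS yS xy; suff -> : S = [set x; y] by [].
by apply/esym/eqP; rewrite eqEcard cards2 xy S2 andbT subUset !sub1set xS.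
Qed.

Lemma sum_eq_mem v : \sum_u (u == v :> T) = 1.
Proof. by rewrite (bigD1 v) //= eqxx big1 // => u /negbTE->. Qed.

End Degree.

(** * Exchanges on a closed trail of maximum size *)

Definition free (T : finType) (e : rel T) (F : seq (T * T)) : rel T :=
  [rel u v | e u v && ((u, v) \notin F)].

Section MaximalTrail.

Variables (T : finType) (e : rel T) (x0 : T) (s0 : seq T).

Let F := walk_arcs x0 s0.
Let V := [set v in x0 :: s0].
Let h := free e F.

Hypothesis e_irr : irreflexive e.
Hypothesis s0_trail : closed_trail e x0 s0.
Hypothesis s0_max : forall Q, coverable e Q -> #|Q| <= #|V|.

Lemma F_uniq : uniq F.
Proof. by case/and3P: s0_trail. Qed.

Lemma tour0 : tour e F x0 s0.
Proof. exact: closed_trail_tour. Qed.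

Lemma tour_memV y s : y \in V -> tour e F y s -> y :: s =i V.
Proof. by rewrite in_set => yV t v; rewrite in_set (tour_mem tour0 t). Qed.

Lemma tour_atV y : y \in V -> exists s, tour e F y s.
Proof. by rewrite in_set => yV; apply: tour_at yV tour0. Qed.

Lemma arcF_tail u v : (u, v) \in F -> u \in V.
Proof. by move=> uv; rewrite inE; apply: walk_arcs_tail uv. Qed.

Lemma arcF_head u v : (u, v) \in F -> v \in V.
Proof. by move=> uv; rewrite !inE (walk_arcs_head uv) orbT. Qed.

Lemma arcF_edge u v : (u, v) \in F -> e u v.
Proof. by have /and3P[p0 _ _] := s0_trail; move: p0; rewrite path_walk_arcs => /allP h0 /h0. Qed.

Lemma no_larger_cover c (Q : {set T}) : c \notin V -> V \subset Q -> coverable e (c |: Q) -> False.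
Proof.
move=> cV VQ /s0_max; apply/negP; rewrite -ltnNge; apply: proper_card.
apply/properP; split; first exact: subset_trans VQ (subsetUr _ _).
by exists c; rewrite ?setU11.
Qed.

Lemma free_outside u v : (u \notin V) || (v \notin V) -> e u v -> h u v.
Proof.
move=> out euv; rewrite /h /free /= euv; apply/negP => uv.
by move: out; rewrite (arcF_tail uv) (arcF_head uv).
Qed.

Lemma free_walk_arcs x p a : path h x p -> a \in walk_arcs x p -> a \notin F.
Proof. by rewrite path_walk_arcs => /allP hp /hp; case: a => u v /= /andP[]. Qed.

Lemma path_free x p : path h x p -> path e x p.
Proof. by apply: sub_path => u v /andP[]. Qed.

(** The path [u] may revisit vertices of [rest]: its arcs are outside [F], and they are distinct
    since their heads are. *)
Lemma splice y d a rest u : tour e F y (d ++ a :: rest) -> path h y u ->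
  last y u = a -> uniq u -> closed_trail e y (u ++ rest).
Proof.
move=> t hu lu uu; have /and3P[] := tour_closed_trail F_uniq t.
case/and3P: (t) => _ _ F_eq.
rewrite cat_path last_cat walk_arcs_cat cat_uniq walk_arcs_cons /=.
case/and3P=> _ _ prest lrest /and4P[_ _ _ urest].
apply/and3P; rewrite cat_path last_cat walk_arcs_cat lu path_free // prest lrest.
rewrite cat_uniq urest walk_arcs_uniq //= andbT; split=> //.
apply/hasP=> -[b b_rest b_u]; have := free_walk_arcs hu b_u.
rewrite -(perm_mem F_eq) walk_arcs_cat /= walk_arcs_cons mem_cat inE.
by rewrite (b_rest : b \in _) !orbT.
Qed.

(** The path from [y] to [z] leaves [V] along some arc [(w, c)]. A simple [h]-path back from [c] to
    [w] closes it to a trail disjoint from [F]; appended to the tour at [w], it adds [c]. *)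
Lemma no_free_cycle y z : y \in V -> z \notin V ->
  connect h y z -> connect h z y -> False.
Proof.
move=> yV zV /connectP[p hp z_eq] zy.
have /split_first_has[p1 [c [p2 [p_eq cV p1V]]]] : has [predC V] p.
  apply/hasP; exists z => //=; rewrite z_eq in zV *.
  by have := mem_last y p; rewrite inE => /predU1P[E|//]; rewrite E yV in zV.
move: hp; rewrite p_eq cat_path /= => /and3P[hp1 hc hp2].
set w := last y p1 in hc.
have wV : w \in V.
  have := mem_last y p1; rewrite -/w inE => /predU1P[-> //|wp1].
  by have /hasPn/(_ _ wp1) /= := p1V; rewrite negbK.
have cw : connect h c w.
  apply: (@connect_trans _ _ z); first by apply/connectP; exists p2; rewrite // z_eq p_eq last_cat.
  by apply: connect_trans zy _; apply/connectP; exists p1.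
case/connectP: cw => q0 /shortenP[q hq uq _] w_eq.
have [s t] := tour_atV wV.
have cc : coverable e (c |: V).
  exists w, (s ++ c :: q); split; last first.
    move=> v; rewrite inE in_set1 -(tour_memV wV t) !inE mem_cat !inE.
    by case/predU1P=> [->|/orP[]->]; rewrite ?eqxx ?orbT.
  case/and3P: (t) => _ _ F_eq.
  apply: closed_trail_cat (tour_closed_trail F_uniq t) _ _.
    by rewrite /closed_trail walk_arcs_uniq // path_free //= -?w_eq ?eqxx // hc.
  apply/hasP=> -[b b_q]; rewrite /= (perm_mem F_eq); apply/negP.
  by apply: free_walk_arcs b_q; rewrite /= hc.
exact: no_larger_cover cV (subxx _) cc.
Qed.

Lemma digon_in_V v w : v \in V -> e v w -> e w v -> w \in V.
Proof.
move=> vV evw ewv; apply: contraT => wV; exfalso.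
by apply: (@no_free_cycle v w) => //; apply: connect1; apply: free_outside; rewrite // wV ?orbT.
Qed.

(** * The sets reached from and reaching an outside vertex *)

Section Outside.

Variable r : T.
Hypothesis rV : r \notin V.

Let A := [set v | connect h r v].
Let B := [set v | connect h v r].

Lemma coreAB_out c : c \in A -> c \in B -> c \notin V.
Proof.
rewrite !inE -/(V) => rc cr; apply/negP => cV.
by apply: (@no_free_cycle c r); rewrite // inE.
Qed.

Lemma reach_closed u v : u \in A -> h u v -> v \in A.
Proof. by rewrite !inE => ru uv; apply: connect_trans ru (connect1 uv). Qed.

Lemma coreach_closed u v : v \in B -> h u v -> u \in B.
Proof. by rewrite !inE => vr uv; apply: connect_trans (connect1 uv) vr. Qed.

(** [c] is the first vertex in [A] on a simple [h]-path from [b] to [r]. It lies in both sets, hence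
    outside [V], and the continuation from [c] to [a] stays in [A], so it avoids the part before
    [c]. *)
Lemma free_ear b a : b \in V -> b \in B -> a \in V -> a \in A ->
  exists u c, [/\ path h b u, last b u = a, uniq u, c \in u & c \notin V].
Proof.
move=> bV bB aV aA; have bA : b \notin A by apply: contraL bV => bA; apply: coreAB_out.
move: (bB); rewrite inE => /connectP[p0 /shortenP[p hp up _] r_eq].
have /split_first_has[p1 [c [p2 [p_eq cA p1A]]]] : has [in A] p.
  apply/hasP; exists r; last by rewrite inE connect0.
  have := mem_last b p; rewrite -r_eq inE => /predU1P[E|//].
  by rewrite -E inE connect0 in bA.
move: hp up r_eq; rewrite p_eq cat_path last_cat /= => /and3P[hp1 hc hp2] /andP[_].
rewrite cat_uniq => /and3P[up1 _ _] r_eq.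
have cr : connect h c r by apply/connectP; exists p2.
have cA' : connect h r c by move: cA; rewrite /= inE.
have : connect h c a by apply: connect_trans cr _; rewrite inE in aA.
case/connectP=> q0 /shortenP[q hq uq _] a_eq.
exists (p1 ++ c :: q), c; split.
- by rewrite cat_path /= hp1 hc.
- by rewrite last_cat.
- rewrite cat_uniq up1 uq andbT; apply/hasP=> -[v vq vp1].
  have /hasPn/(_ _ vp1)/negP := p1A; apply; rewrite /= inE.
  apply: connect_trans cA' _.
  exact: path_connect hq _ vq.
- by rewrite mem_cat inE eqxx orbT.
- by apply: coreAB_out; rewrite ?inE.
Qed.

(** The basic exchange: [c] is gained and only vertices of [d] can be lost. *)
Lemma segment_cover b d a rest : tour e F b (d ++ a :: rest) ->
  b \in V -> b \in B -> a \in A ->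
  exists2 c, c \notin V & coverable e (c |: [set v in a :: rest]).
Proof.
move=> t bV bB aA.
have aV : a \in V by rewrite -(tour_memV bV t) inE mem_cat mem_head !orbT.
have [u [c [hu lu uu cu cV]]] := free_ear bV bB aV aA.
exists c => //; exists b, (u ++ rest); split; first exact: splice t hu lu uu.
move=> v; rewrite !inE mem_cat => /or3P[/eqP->|/eqP->|->]; rewrite ?cu ?orbT //.
by have := mem_last b u; rewrite lu inE => /orP[]->; rewrite ?orbT.
Qed.

Lemma tour_start_mem b d a rest : tour e F b (d ++ a :: rest) -> b \in a :: rest.
Proof.
by case/and3P=> _ /eqP; rewrite last_cat /= => lb _; have := mem_last a rest; rewrite lb.
Qed.

Lemma no_BA_arc b a : (b, a) \in F -> b \in B -> a \in A -> False.
Proof.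
move=> ba bB aA; have bV := arcF_tail ba.
have [s t] := tour_arc ba tour0.
(* With no interior the exchange loses no vertex. *)
have [c cV] := @segment_cover b [::] a s t bV bB aA.
apply: no_larger_cover => //; apply/subsetP=> v; rewrite -(tour_memV bV t) !in_set inE.
by case/predU1P=> [->|//]; apply: tour_start_mem (t : tour _ _ _ ([::] ++ _)).
Qed.

(** The segment is shrunk: its new end is the first vertex in [A], its new start the last vertex in
    [B] before that. What is cut off moves to the retained part of the tour. *)
Lemma segment_interior b d a rest : tour e F b (d ++ a :: rest) ->
  b \in V -> b \in B -> a \in A ->
  exists b' d' a' rest', [/\ tour e F b' (d' ++ a' :: rest'),
    [/\ b' \in V, b' \in B & a' \in A], {subset rest <= a' :: rest'} &
    {subset d' <= d} /\ {in d', forall v, v \notin A :|: B}].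
Proof.
move=> t bV bB aA.
have /split_first_has[d1 [a1 [d2 [dE aA1 d1A]]]] : has [in A] (rcons d a).
  by apply/hasP; exists a; rewrite // mem_rcons mem_head.
have {}t : tour e F b (d1 ++ a1 :: d2 ++ rest).
  by move: t; rewrite -cat_rcons dE -catA.
have [b1 [d3 [d1' [bE bB1 d3B]]]] : exists b1 d3 d1',
    [/\ b :: d1 = d1' ++ b1 :: d3, b1 \in B & ~~ has [in B] d3].
  have /split_last_has[d1' [b1 [d3 [-> ? ?]]]] : has [in B] (b :: d1) by rewrite /= bB.
  by exists b1, d3, d1'.
have d1d : {subset d1 <= d}.
  move=> v vd1; have : v \in rcons d a by rewrite dE mem_cat vd1.
  rewrite mem_rcons inE => /predU1P[va|//]; move/hasPn: d1A => /(_ _ vd1).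
  by rewrite va aA.
have d3d1 : {subset d3 <= d1}.
  by case: d1' bE => [|_ d1'] [_ ->] // v vd; rewrite mem_cat inE vd !orbT.
exists b1, d3, a1.
have [rest' t' sub] : exists2 rest', tour e F b1 (d3 ++ a1 :: rest')
    & {subset d2 ++ rest <= rest'}.
  case: d1' bE => [|b2 d1'] [b_eq d1E]; first by exists (d2 ++ rest) => //; rewrite -b_eq -d1E.
  exists ((d2 ++ rest) ++ rcons d1' b1); last first.
    by move=> v; rewrite [_ \in _ ++ rcons _ _]mem_cat => ->.
  have {}t : tour e F b (rcons d1' b1 ++ (d3 ++ a1 :: d2 ++ rest)).
    by rewrite catA cat_rcons -d1E.
  by have := tour_rot t; rewrite last_rcons -!catA /= -!catA.
exists rest'; split=> //.
- split=> //; have : b1 \in b :: d1 by rewrite bE mem_cat mem_head orbT.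
  by rewrite -(tour_memV bV t) !inE mem_cat => /orP[]->; rewrite ?orbT.
- by move=> v vr; rewrite inE sub ?orbT // mem_cat vr orbT.
split; first by move=> v /d3d1/d1d.
move=> v vd3; rewrite inE negb_or.
by have /hasPn/(_ _ vd3) -> := d3B; have /hasPn/(_ _ (d3d1 _ vd3)) -> := d1A.
Qed.


Lemma coverable_digons p (Q : {set T}) (s : seq T) : p \in Q -> coverable e Q ->
  {in s, forall z, e p z && e z p} -> coverable e ([set v in s] :|: Q).
Proof.
move=> pQ cQ; elim: s => [|z s IH] dig; first by rewrite set_nil set0U.
have /andP[pz zp] := dig _ (mem_head _ _).
rewrite set_cons -setUA; apply: coverable_digon pz zp _ _; first by rewrite inE pQ orbT.
by apply: IH => v vs; apply: dig; rewrite inE vs orbT.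
Qed.

Lemma card_pred_to_p p b : (b, p) \in F -> b \in B -> p \notin A ->
  #|[set a in A | e a p]| <=
  #|[set z | [&& z \notin A :|: B, z != p & ~~ (e p z && e z p)]]|.
Proof.
move=> bp bB pA; have pV := arcF_head bp; have bV := arcF_tail bp.
have ebp := arcF_edge bp.
have bp_neq : p != b by apply: contraTneq ebp => ->; rewrite e_irr.
have [s t] := tour_atV pV.
(* The private vertex found for a is mapped back to a by next_pred p s. *)
apply: leq_trans (leq_imset_card (next_pred p s) _); apply: subset_leq_card.
apply/subsetP=> a; rewrite inE => /andP[aA eap].
have ap : p != a by apply: contraTneq eap => <-; rewrite e_irr.
have apF : (a, p) \in F.
  by apply: contraR pA => apF; apply: reach_closed aA _; rewrite /h /free /= eap.
have ab : b != a.
  by apply: contraTneq bV => ba; apply: coreAB_out => //; rewrite ba.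
have /walk_arcs_split[s1 [s2 [s_eq]]] : (a, p) \in walk_arcs p s.
  by case/and3P: t => _ _ /perm_mem->.
case/lastP: s1 s_eq => [|s1 a1] s_eq; first by move=> /= E; rewrite E eqxx in ap.
rewrite last_rcons => a_eq; rewrite {a1}a_eq cat_rcons in s_eq.
(* [c2] followed by [a], [p] is the piece of the tour since the preceding visit to [p]. *)
have [G [c2 [s1E lG pc2]]] := split_last_visit p s1.
rewrite s1E -catA in s_eq.
have t1 : tour e F p (c2 ++ a :: p :: s2 ++ G).
  by have := t; rewrite s_eq => /tour_rot; rewrite lG -!catA.
(* Within the piece only [(a, p)] enters [p], so [(b, p)] lies outside it. *)
have /walk_arcs_split[k1 [k2 [K_eq]]] : (b, p) \in walk_arcs p (s2 ++ G).
  case/and3P: t1 => _ _ /perm_mem/(_ (b, p)); rewrite bp -(cat_rcons a) walk_arcs_cat.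
  rewrite (last_rcons p c2 a : last p _ = a).
  rewrite mem_cat walk_arcs_cons inE xpair_eqE (negbTE ab) /= => /orP[] //.
  by move/walk_arcs_head; rewrite mem_rcons inE (negbTE ap) (negbTE pc2).
move=> lk1.
(* The closed trails through p are reordered so that (b, p) is followed by the
   piece c2 that ends with (a, p). *)
have t2 : tour e F b ((p :: c2) ++ a :: p :: k2 ++ k1).
  have {}t1 : tour e F p ((c2 ++ [:: a; p]) ++ (k1 ++ [:: p]) ++ k2).
    by rewrite -!catA /= -K_eq.
  have := tour_swap _ _ t1; rewrite !last_cat /= => /(_ erefl erefl).
  rewrite -!catA => /tour_rot; rewrite lk1 /=.
  by rewrite -!catA.
have [b' [d' [a' [rest' [t3 [b'V b'B a'A] sub [d'c2 d'Z]]]]]] := segment_interior t2 bV bB aA.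
have [c cV cQ] := segment_cover t3 b'V b'B a'A.
set Q := [set v in a' :: rest'] in cQ.
have pQ : p \in Q by rewrite inE sub ?mem_head.
(* The exchange keeps [p]. If every lost vertex formed a 2-cycle with [p], all could be hooked up
   there again. *)
have /hasP[z zd' /andP[zQ zp]] : has (fun z => (z \notin Q) && ~~ (e p z && e z p)) d'.
  apply/negPn/negP => /hasPn all_dig.
  have := @coverable_digons p (c |: Q) [seq v <- d' | v \notin Q].
  rewrite inE pQ orbT setUCA => /(_ isT cQ) /(fun P => no_larger_cover cV _ (P _)).
  apply.
    apply/subsetP=> v; rewrite -(tour_memV b'V t3) => vt; rewrite 2!inE mem_filter.
    have [//|vQ] := boolP (v \in Q); rewrite ?orbT // orbF /=.
    move: vt; rewrite inE => /predU1P[vb|].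
      by move: vQ; rewrite inE vb (tour_start_mem t3).
    by rewrite mem_cat => /orP[//|]; move: vQ; rewrite inE => /negP.
  move=> v; rewrite mem_filter => /andP[vQ vd'].
  by have := all_dig _ vd'; rewrite vQ negbK.
have zp_neq : z != p by apply: contraNneq zQ => ->.
apply/imsetP; exists z; first by rewrite inE d'Z // zp_neq.
rewrite s_eq next_predE //.
  (* Vertices of the tour outside the piece are retained, so the lost [z] does not occur in [G] and
     [next_pred] finds the right piece. *)
  apply: contra zQ => zG; rewrite inE; apply: sub.
  have : z \in s2 ++ G by rewrite mem_cat zG orbT.
  by rewrite K_eq !(mem_cat, inE) => /or3P[]->; rewrite ?orbT.
by have := d'c2 _ zd'; rewrite inE (negbTE zp_neq).
Qed.


(** * Degree bounds *)

Let C := A :&: B.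
Let N c := [set v | [&& v \notin C, ~~ e v c & ~~ e c v]].

(** A vertex joined to [c] in both directions lies in [C]. So [c] shares at most 2 arcs with each
    other vertex of [C], none with [N c], and at most 1 with any remaining vertex. *)
Lemma deg_out c : c \in C -> deg e c + #|N c| + 2 <= #|T| + #|C|.
Proof.
move=> cC; have /setIP[cA cB] := cC; have cV := coreAB_out cA cB.
(* Written with indicators of [c], the constant lets the inequality be checked vertex by vertex. *)
have -> : 2 = \sum_u ((u == c) + (u == c)) by rewrite big_split /= !sum_eq_mem.
rewrite deg_sum !card_sum_mem -sum1_card -!big_split /=; apply: leq_sum => v _.
rewrite [v \in N c]inE; have [->|vc] := eqVneq v c; first by rewrite cC e_irr.
have [vC|vC] := boolP (v \in C); first by case: (e v c); case: (e c v).
case evc: (e v c); case ecv: (e c v) => //.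
case/negP: vC; apply/setIP; split.
  by apply: reach_closed cA _; apply: free_outside; rewrite // cV.
by apply: coreach_closed cB _; apply: free_outside; rewrite // cV orbT.
Qed.

Lemma nonreach_subset_N c : c \in C -> ~: (A :|: B) \subset N c.
Proof.
move=> /setIP[cA cB]; have cV := coreAB_out cA cB; apply/subsetP=> v.
rewrite in_setC in_setU negb_or [v \in N c]inE in_setI => /andP[vA vB].
rewrite (negbTE vA) /=; apply/andP; split.
  by apply: contra vB => evc; apply: coreach_closed cB _; apply: free_outside; rewrite // cV orbT.
by apply: contra vA => ecv; apply: reach_closed cA _; apply: free_outside; rewrite // cV.
Qed.

Lemma deg_exit p b : (b, p) \in F -> b \in B -> p \notin A ->
  {in C, forall c, ~~ e p c} -> deg e p + #|A| + #|C| + 2 <= 2 * #|T|.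
Proof.
move=> bp bB pA pC; have := card_pred_to_p bp bB pA.
set Ap := [set a in _ | _]; set Y := [set z | _] => ApY.
(* Checked vertex by vertex: only in-neighbours of [p] in [A] can exceed 2, by 1, and
   [#|Ap| <= #|Y|] pays for them. *)
suff : deg e p + #|A| + #|C| + #|Y| + (\sum_u (u == p) + \sum_u (u == p))
    <= #|T| + #|T| + #|Ap|.
  by rewrite sum_eq_mem; move: (deg e p) #|A| #|C| #|Y| #|Ap| #|T| ApY; clear; lia.
rewrite deg_sum !card_sum_mem -sum1_card -!big_split /=; apply: leq_sum => v _.
rewrite [v \in Y]inE [v \in Ap]inE in_setI in_setU.
have [->|vp] := eqVneq v p; first by rewrite e_irr (negbTE pA) /= andbF.
have [vA|vA] /= := boolP (v \in A); last by case: (v \in B); case: (e v p); case: (e p v).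
have [vB|vB] /= := boolP (v \in B); last by case: (e v p); case: (e p v).
rewrite (negbTE (pC v _)) ?inE ?vA ?vB //; last by apply/andP; move: vA vB; rewrite !inE.
by case: (e v p).
Qed.

(** An arc between [v] and [C], in either direction, would put [v] in [A] or [B]; elsewhere, two
    arcs shared with one vertex form a 2-cycle. *)
Lemma deg_nonreach v : v \in V -> v \notin A :|: B ->
  deg e v + 1 + #|C| <= #|T| + #|[set u | e u v && e v u]|.
Proof.
move=> vV; rewrite in_setU negb_or => /andP[vA vB].
rewrite -(sum_eq_mem v) deg_sum !card_sum_mem -sum1_card -!big_split /=.
apply: leq_sum => u _; rewrite inE in_setI.
have [->|uv] := eqVneq u v; first by rewrite e_irr (negbTE vA).
have [/andP[uA uB]|_] := boolP (_ && _); last by case: (e u v); case: (e v u).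
have uV := coreAB_out uA uB.
rewrite (negbTE (_ : ~~ e u v)); last first.
  by apply: contra vA => euv; apply: reach_closed uA _; apply: free_outside; rewrite // uV.
rewrite (negbTE (_ : ~~ e v u)) //.
by apply: contra vB => evu; apply: coreach_closed uB _; apply: free_outside; rewrite // uV orbT.
Qed.


(** * Use of the degree condition *)

Hypothesis deg_large : forall u v, nonadjacent e u v ->
  dominated e u v || dominating e u v -> 5 * #|T| <= 2 * (deg e u + deg e v) + 11.

(** Combining [deg_out] and [deg_nonreach] with the degree condition gives n - 5 <= 2(D - t), with D
    the number of 2-cycles at [v] and t the size of [N c]. For n at least 4 the right side is at
    least -1, hence nonnegative by parity. *)
Lemma digons_many c v : 3 < #|T| -> c \in C -> v \in V -> v \notin A :|: B ->
  dominated e v c || dominating e v c ->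
  #|N c| <= #|[set u | e u v && e v u]|.
Proof.
move=> n4 cC vV vAB dom; have := deg_nonreach vV vAB; have := deg_out cC.
have := subsetP (nonreach_subset_N cC) v; rewrite !in_setC vAB => /(_ isT).
rewrite inE => /and3P[vC evc ecv].
have vc : v != c by apply: contraNneq vC => ->.
have := deg_large _ dom; rewrite /nonadjacent vc evc ecv => /(_ isT).
move: (deg e v) (deg e c) #|N c| #|C| #|[set u | _]| #|T| n4; clear; lia.
Qed.

(** With [N c] of size at most 2, an exchanged segment loses at most two vertices, and 2-cycles,
    from [digons_many] or from the segment itself, hook them up again. *)
Lemma nonneighbours_gt2 b p c a0 : (b, p) \in F -> c \in C -> e b c ->
  {in C, forall c', ~~ e p c'} -> a0 \in V -> a0 \in A -> 2 < #|N c|.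
Proof.
move=> bp cC ebc pC a0V a0A; have bV := arcF_tail bp.
have [cA cB] := setIP cC; have cV := coreAB_out cA cB.
have bB : b \in B by apply: coreach_closed cB _; apply: free_outside; rewrite // cV orbT.
have notA v : v \in V -> v \in B -> v \notin A.
  by move=> vV vB; apply: contraL vV => vA; apply: coreAB_out.
have pA : p \notin A by apply/negP; apply: no_BA_arc bp bB.
have pN : p \in N c.
  rewrite inE pC // [p \in C]inE (negbTE pA) /=.
  by apply: contra pA => ecp; apply: reach_closed cA _; apply: free_outside; rewrite // cV.
have ebp := arcF_edge bp.
rewrite ltnNge; apply/negP => N2.
have [s t] := tour_atV bV.
have /splitPr s_split : a0 \in s.
  have := a0V; rewrite -(tour_memV bV t) inE => /predU1P[E|//].
  by have := notA _ bV bB; rewrite -E a0A.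
case: s_split t => d0 rest0 t.
have [b' [d [a [rest [t1 [b'V b'B aA] _ [_ dZ]]]]]] := segment_interior t bV bB a0A.
have [c1 c1V cQ] := segment_cover t1 b'V b'B aA.
set Q := [set v in a :: rest] in cQ.
have aV : a \in V by rewrite -(tour_memV b'V t1) inE mem_cat mem_head !orbT.
have VQ v : v \in V -> v \notin d -> v \in Q.
  rewrite -(tour_memV b'V t1) [v \in Q]in_set in_cons mem_cat => /or3P[/eqP->|->//|//] _.
  exact: tour_start_mem t1.
case: d dZ t1 VQ => [|u1 d] dZ t1 VQ.
  by apply: no_larger_cover c1V _ cQ; apply/subsetP=> v /VQ; apply.
have dV : {subset u1 :: d <= V}.
  by move=> v vd; rewrite -(tour_memV b'V t1) inE mem_cat vd orbT.
have dN : {subset u1 :: d <= N c}.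
  by move=> v /dZ vAB; apply: (subsetP (nonreach_subset_N cC)); rewrite in_setC.
have [u1V u1N u1Z] : [/\ u1 \in V, u1 \in N c & u1 \notin A :|: B].
  by split; [apply: dV | apply: dN | apply: dZ]; rewrite mem_head.
have n4 : 4 <= #|T|.
  have : uniq [:: c; u1; b'; a].
    have ne x y : x \notin V -> y \in V -> x != y by move=> xV; apply: contraTneq => <-.
    move: u1Z; rewrite in_setU negb_or => /andP[u1A u1B].
    rewrite /= !inE !negb_or (ne c u1) ?(ne c b') ?(ne c a) //= andbT -andbA.
    apply/and3P; split=> //.
    - by apply: contraNneq u1B => ->.
    - by apply: contraNneq u1A => ->.
    - by apply: contraNneq (notA _ b'V b'B) => ->.
  by move/card_uniqP=> E; rewrite -[4]/(size [:: c; u1; b'; a]) -E max_card.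
have Npos : 0 < #|N c| by apply/card_gt0P; exists p.
case/and3P: (t1) => pt1 _ _; move: pt1.
rewrite cat_path /= => /andP[/andP[eb'u1 pd] /andP[ela _]].
(* Adjacency to [c] has a forced direction: an arc from [c] puts its head in [A], an arc to [c] puts
   its tail in [B], and no vertex of [V] is in both. *)
have nbr v : v \in V -> v \notin N c -> (v \in B -> e v c) /\ (v \in A -> e c v).
  move=> vV vN.
  have vC : v \notin C by apply: contraL vV => /setIP[]; apply: coreAB_out.
  move: vN; rewrite in_set vC /= negb_and !negbK => /orP[evc|ecv].
    split=> // vA; suff vB : v \in B by have := notA _ vV vB; rewrite vA.
    by apply: coreach_closed cB _; apply: free_outside; rewrite // cV orbT.
  split=> // vB; have := notA _ vV vB; case/negP.
  by apply: reach_closed cA _; apply: free_outside; rewrite // cV.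
have dominatedI v w : e w v -> e w c -> dominated e v c || dominating e v c.
  by move=> wv wc; apply/orP; left; apply/existsP; exists w; rewrite wv.
have dominatingI v w : e v w -> e c w -> dominated e v c || dominating e v c.
  by move=> vw cw; apply/orP; right; apply/existsP; exists w; rewrite vw.
have attach v w (Q' : {set T}) : e w v && e v w -> w \in Q' ->
    coverable e (c1 |: Q') -> coverable e (c1 |: (v |: Q')).
  move=> /andP[wv vw] wQ' cQ'; rewrite setUCA; apply: coverable_digon wv vw _ cQ'.
  by rewrite inE wQ' orbT.
(* Either [u1] is the only interior vertex, or the interior consists of [u1] and one further vertex
   [y], possibly with repetitions. *)
have [/allP d_const|/allPn[y yd yu1]] := boolP (all (pred1 u1) d).
  have lu1 : last u1 d = u1.
    by have := mem_last u1 d; rewrite inE => /predU1P[//|/d_const/eqP].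
  have dom : dominated e u1 c || dominating e u1 c.
    (* If [u1] is not [p], these two exhaust [N c], so [c] has an arc to [a], as does [u1], the last
       interior vertex. *)
    have [u1p|u1p] := eqVneq u1 p; first by rewrite u1p; apply: dominatedI ebp ebc.
    apply: (@dominatingI _ a); first by rewrite lu1 in ela.
    apply: (proj2 (nbr _ aV _)) => //; apply: contraL aA => aN.
    have := card_le2_mem N2 u1N pN u1p aN; rewrite !inE => /orP[]/eqP->.
      by move: u1Z; rewrite !inE negb_or => /andP[].
    by move: pA; rewrite inE.
  have := digons_many n4 cC u1V u1Z dom => dig.
  have /card_gt0P[w] : 0 < #|[set u | e u u1 && e u1 u]| by apply: leq_trans dig.
  rewrite inE => wu1; have wV : w \in V by case/andP: wu1 => ? ?; apply: digon_in_V u1V _ _.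
  have wd : w \notin u1 :: d.
    have wu : w != u1 by apply: contraTneq wu1 => ->; rewrite e_irr.
    by rewrite inE negb_or wu; apply: contra wu => /d_const.
  apply: no_larger_cover c1V _ (attach _ _ _ wu1 (VQ _ wV wd) cQ).
  apply/subsetP=> v vV; rewrite in_setU in_set1.
  have [//|vu] := eqVneq v u1; apply: VQ => //.
  by rewrite inE negb_or vu; apply: contra vu => /d_const.
have {}yu1 : y != u1 by [].
have u1y : u1 != y by rewrite eq_sym.
have yd1 : y \in u1 :: d by rewrite inE yd orbT.
have N_eq v : v \in N c -> v \in [set u1; y] by apply: card_le2_mem => //; apply: dN.
have notN v : v \in A :|: B -> v \notin N c.
  move=> vAB; apply/negP => /N_eq; rewrite !in_set2 => /orP[]/eqP E.
    by move: u1Z; rewrite -E vAB.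
  by have := dZ _ yd1; rewrite -E vAB.
have eb'c : e b' c by apply: (proj1 (nbr _ b'V _)) => //; apply: notN; rewrite in_setU b'B orbT.
have eca : e c a by apply: (proj2 (nbr _ aV _)) => //; apply: notN; rewrite in_setU aA.
have NE : #|N c| = 2.
  apply/eqP; rewrite eqn_leq N2 /=.
  have : [set u1; y] \subset N c by rewrite subUset !sub1set u1N dN.
  by move/subset_leq_card; rewrite cards2 u1y.
have := digons_many n4 cC u1V u1Z (dominatedI _ _ eb'u1 eb'c).
set D1 := [set u | e u u1 && e u1 u] => dig1.
(* [u1] has at least two 2-cycle partners, so one of them differs from [y] and is retained. *)
have /card_gt0P[w] : 0 < #|D1 :\ y|.
  by move: dig1; rewrite NE (cardsD1 y); case: (y \in D1); [|apply: ltnW].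
rewrite !inE => /andP[wy wu1].
have wV : w \in V by case/andP: wu1 => ? ?; apply: digon_in_V u1V _ _.
have wQ : w \in Q.
  apply: VQ => //; apply/negP => /dN/N_eq; rewrite !inE (negbTE wy) orbF => /eqP wu.
  by move: wu1; rewrite wu e_irr.
have cQ1 := attach _ _ _ wu1 wQ cQ.
have inQ1 v : v \in V -> v != y -> v \in u1 |: Q.
  move=> vV vy; rewrite in_setU in_set1; have [//|vu] := eqVneq v u1.
  by apply: VQ => //; apply/negP => /dN/N_eq; rewrite !inE (negbTE vu) (negbTE vy).
have [w2 w2y w2Q] : exists2 w2, e w2 y && e y w2 & w2 \in u1 |: Q.
  have : last u1 d \in [set u1; y] by apply/N_eq/dN; apply: mem_last.
  rewrite !in_set2 => /orP[]/eqP ld; last first.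
    rewrite ld in ela.
    have dig2 := digons_many n4 cC (dV _ yd1) (dZ _ yd1) (dominatingI _ _ ela eca).
    have /card_gt0P[w2] : 0 < #|[set u | e u y && e y u]| by apply: leq_trans dig2.
    rewrite inE => w2y; exists w2 => //; apply: inQ1.
      by case/andP: w2y => ? ?; apply: digon_in_V (dV _ yd1) _ _.
    by apply: contraTneq w2y => ->; rewrite e_irr.
  (* The interior goes from [u1] to [y] and directly back to [u1], so these two form a 2-cycle. *)
  exists u1; last by rewrite setU11.
  have step x v : e x v -> v \in u1 :: d -> (v != x) && (v \in [set u1; y]).
    by move=> exv /dN/N_eq ->; rewrite andbT; apply: contraTneq exv => ->; rewrite e_irr.
  have next_u1 v : e u1 v -> v \in u1 :: d -> v = y.
    by move=> ev /(step _ _ ev); rewrite in_set2 => /andP[/negbTE->] /eqP.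
  have next_y v : e y v -> v \in u1 :: d -> v = u1.
    by move=> ev /(step _ _ ev); rewrite in_set2 => /andP[/negbTE->]; rewrite orbF => /eqP.
  case: (d) pd ld yd next_u1 next_y => [//|v2 [|v3 d3]] /=.
    by move=> _ -> ; rewrite inE (negbTE yu1).
  move=> /and3P[e1 e2 _] _ _ next_u1 next_y.
  have v2y : v2 = y by apply: next_u1; rewrite // !inE eqxx orbT.
  rewrite v2y in e1 e2; rewrite e1 /=.
  by rewrite -(next_y _ e2) // !inE eqxx !orbT.
apply: no_larger_cover c1V _ (attach _ _ _ w2y w2Q cQ1).
apply/subsetP=> v vV; rewrite in_setU in_set1.
by have [//|vy] := eqVneq v y; apply: inQ1.
Qed.

(** [S] is [N c] for the vertex [c] found in the proof. *)
Lemma reach_bound b0 a0 : b0 \in V -> e b0 r -> a0 \in V -> a0 \in A ->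
  exists S : {set T}, [/\ ~: (A :|: B) \subset S, 2 < #|S| & 2 * (#|A| + #|S|) <= #|T| + 3].
Proof.
move=> b0V eb0r a0V a0A.
pose P v := [exists c, (c \in C) && e v c].
have rC : r \in C by rewrite !inE !connect0.
have Pb0 : P b0 by apply/existsP; exists r; rewrite rC.
have PB v : P v -> v \in B.
  case/existsP=> c /andP[/setIP[cA cB] evc].
  apply: (@coreach_closed v c) => //.
  by apply: free_outside evc; rewrite (coreAB_out cA cB) orbT.
have Pa0 : ~~ P a0 by apply: contraL a0V => /PB; apply: coreAB_out.
have [s t] := tour_atV b0V.
(* [b0] satisfies [P] and [a0] does not, so the tour has an arc [(b, p)] on which [P] first
   fails. *)
have /split_first_has[s1 [p [s2 [s_eq nPp Ps1]]]] : has [predC P] s.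
  apply/hasP; exists a0 => //; have := a0V; rewrite -(tour_memV b0V t) inE.
  by case/predU1P=> // E; rewrite E Pb0 in Pa0.
set b := last b0 s1.
have Pb : P b.
  have := mem_last b0 s1; rewrite -/b inE => /predU1P[->//|bs1].
  by have /hasPn/(_ _ bs1) := Ps1; rewrite /= negbK.
have bp : (b, p) \in F.
  case/and3P: t => _ _ /perm_mem<-.
  by rewrite s_eq walk_arcs_cat -/b mem_cat walk_arcs_cons mem_head orbT.
have /existsP[c /andP[cC ebc]] := Pb.
have pC : {in C, forall c', ~~ e p c'}.
  have {}nPp : ~~ P p by [].
  move=> c' c'C; apply: contra nPp => epc'.
  by apply/existsP; exists c'; rewrite c'C.
have pA : p \notin A by apply/negP; apply: no_BA_arc bp (PB _ Pb).
have [cA cB] := setIP cC; have cV := coreAB_out cA cB.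
have pV := arcF_head bp.
have pc : p != c by apply: contraTneq pV => ->.
have ecp : ~~ e c p.
  by apply: contra pA => ecp; apply: reach_closed cA _; apply: free_outside; rewrite // cV.
have ebp := arcF_edge bp.
exists (N c); split.
- exact: nonreach_subset_N.
- exact: nonneighbours_gt2 bp cC ebc pC a0V a0A.
(* Together, deg p + deg c <= 3n - |A| - t - 4 with t the size of [N c]; comparing twice this with
   5n - 11 leaves 2(|A| + t) <= n + 3. *)
have := deg_exit bp (PB _ Pb) pA pC; have := deg_out cC.
have : dominated e p c || dominating e p c.
  by apply/orP; left; apply/existsP; exists b; rewrite ebp.
move/deg_large; rewrite /nonadjacent pc ecp pC // => /(_ isT).
move: (deg e p) (deg e c) #|N c| #|C| #|A| #|T|; clear; lia.
Qed.

End Outside.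
End MaximalTrail.

(** * Reversal of all arcs *)

Section Reversal.

Variables (T : finType) (e e' : rel T).
Hypothesis e'E : forall x y, e' x y = e y x.

Lemma last_rev_belast (x : T) p : last (last x p) (rev (belast x p)) = x.
Proof. by case: p => //= y p; rewrite rev_cons last_rcons. Qed.

Lemma walk_arcs_rev (x : T) p : walk_arcs (last x p) (rev (belast x p)) =
  rev [seq (a.2, a.1) | a <- walk_arcs x p].
Proof.
elim: p x => [//|y p IH] x; rewrite walk_arcs_cons map_cons [belast _ _]/= [last x _]/=.
by rewrite !rev_cons -!cats1 walk_arcs_cat IH last_rev_belast.
Qed.

Lemma mem_walk_arcs_rev (x : T) p u v : last x p = x ->
  ((u, v) \in walk_arcs x (rev (belast x p))) = ((v, u) \in walk_arcs x p).
Proof.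
move=> lx; rewrite -{1}lx walk_arcs_rev mem_rev; apply/mapP/idP => [[[a b] ab [-> ->]] //|vu].
by exists (v, u).
Qed.

Lemma mem_rev_belast (x : T) p : last x p = x -> x :: rev (belast x p) =i x :: p.
Proof.
by move=> lx v; rewrite (lastI x p) lx mem_rcons !inE mem_rev.
Qed.

Lemma closed_trail_rev x p : closed_trail e x p -> closed_trail e' x (rev (belast x p)).
Proof.
case/and3P=> pp /eqP lx up; apply/and3P; split.
- by rewrite -{1}lx rev_path (eq_path (e' := e)).
- by rewrite -{1}lx last_rev_belast.
- by rewrite -{1}lx walk_arcs_rev rev_uniq map_inj_uniq // => -[a b] [c d] [-> ->].
Qed.

Lemma coverable_rev Q : coverable e Q -> coverable e' Q.
Proof.
case=> x [p [cp Qp]]; exists x, (rev (belast x p)); split; first exact: closed_trail_rev.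
by move=> v /Qp; rewrite mem_rev_belast //; case/and3P: cp => _ /eqP.
Qed.

Lemma deg_rev v : deg e' v = deg e v.
Proof. by rewrite !deg_sum; apply: eq_bigr => u _; rewrite !e'E addnC. Qed.

(** Turns a bound on the set [A] of the reversed digraph into one on the set [B] of the original. *)
Lemma connect_free_rev (x : T) p : last x p = x ->
  connect (free e' (walk_arcs x (rev (belast x p)))) =2
  fun u v => connect (free e (walk_arcs x p)) v u.
Proof.
move=> lx u v; rewrite -[RHS](connect_rev (free e (walk_arcs x p)) u v).
by apply: eq_connect => a b; rewrite /free /= e'E mem_walk_arcs_rev.
Qed.

End Reversal.

(** * A maximum closed trail and the final count *)

Lemma max_closed_trail (T : finType) (e : rel T) (x : T) : exists x0 s0,
  closed_trail e x0 s0 /\ forall Q, coverable e Q -> #|Q| <= #|[set v in x0 :: s0]|.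
Proof.
(* A trail has at most as many arcs as there are pairs of vertices; bounding its length makes [P]
   decidable. *)
pose P m := [exists x0, [exists s : #|{: T * T}|.-bseq T,
  closed_trail e x0 s && (#|[set v in x0 :: s]| == m)]].
have P_trail x0 s : closed_trail e x0 s -> P #|[set v in x0 :: s]|.
  move=> cs; have size_s : size s <= #|{: T * T}|.
    case/and3P: cs => _ _ /card_uniqP E; have := max_card (mem (walk_arcs x0 s)).
    by rewrite E -(size_map snd) [map _ _]unzip2_walk_arcs.
  by apply/existsP; exists x0; apply/existsP; exists (Bseq size_s); rewrite cs eqxx.
have exP : exists m, P m.
  exists #|[set v in [:: x]]|.
  by apply: P_trail; rewrite /closed_trail /= eqxx.
have leP m : P m -> m <= #|T|.
  by case/existsP=> x0 /existsP[s /andP[_ /eqP<-]]; apply: max_card.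
case: (ex_maxnP exP leP) => m /existsP[x0 /existsP[s /andP[cs /eqP m_eq]]] m_max.
exists x0, s; split=> // Q [x1 [s1 [cs1 Qs1]]].
rewrite m_eq; apply: leq_trans (m_max _ (P_trail _ _ cs1)).
by apply/subset_leq_card/subsetP => v /Qs1; rewrite inE.
Qed.

(** The degree condition is doubled and its subtraction moved across, which keeps it in the natural
    numbers. *)
Lemma supereulerian_deg (T : finType) (e : rel T) :
  irreflexive e -> 0 < #|T| -> strong e ->
  (forall u v, nonadjacent e u v -> dominated e u v || dominating e u v ->
    5 * #|T| <= 2 * (deg e u + deg e v) + 11) ->
  supereulerian e.
Proof.
move=> e_irr /card_gt0P[x _] e_strong deg_large.
have [x0 [s0 [cs0 s0_max]]] := max_closed_trail e x.
exists x0, s0; split=> // r0; apply: contraT => r0V; exfalso.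
set V := [set v in x0 :: s0] in s0_max.
have x0V : x0 \in V by rewrite inE mem_head.
have {}r0V : r0 \notin V by rewrite inE.
set h := free e (walk_arcs x0 s0).
have [b [x1 [bV x1V ebx1]]] : exists b x1, [/\ b \in V, x1 \notin V & e b x1].
  have /connectP[p pp r0E] := e_strong x0 r0.
  have /split_first_has[p1 [x1 [p2 [pE x1V p1V]]]] : has [predC V] p.
    apply/hasP; exists r0 => //; have := mem_last x0 p; rewrite -r0E inE => /predU1P[E|//].
    by rewrite E x0V in r0V.
  exists (last x0 p1), x1; split=> //.
    have := mem_last x0 p1; rewrite inE => /predU1P[-> //|lp1].
    by have /hasPn/(_ _ lp1) := p1V; rewrite /= negbK.
  by move: pp; rewrite pE cat_path /= => /and3P[].
(* Preceded by [b], the walk from [x1] to [xl] and on to [s] has only its two ends in [V], so all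
   its arcs are free. *)
have [xl [s [x1xl xlV sV exls]]] : exists xl s, [/\ connect h x1 xl, xl \notin V, s \in V & e xl s].
  have /connectP[p pp x0E] := e_strong x1 x0.
  have /split_first_has[p1 [s [p2 [pE sV p1V]]]] : has [in V] p.
    apply/hasP; exists x0 => //; have := mem_last x1 p; rewrite -x0E inE => /predU1P[E|//].
    by rewrite -E x0V in x1V.
  have out v : v \in x1 :: p1 -> v \notin V.
    by rewrite inE => /predU1P[->//|vp]; have /hasPn/(_ _ vp) := p1V.
  move: pp; rewrite pE cat_path /= => /and3P[pp1 es _].
  exists (last x1 p1), s; split=> //; last by apply: out; apply: mem_last.
  apply/connectP; exists p1 => //.
  move: out; elim: p1 (x1) pp1 {es p1V pE} => //= v p1 IH y /andP[eyv pp1] out.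
  rewrite IH ?andbT //; last by move=> w wp; apply: out; rewrite inE wp orbT.
  by apply: (@free_outside _ e x0 s0) => //; rewrite out ?mem_head.
have lx0 : last x0 s0 = x0 by case/and3P: cs0 => _ /eqP.
pose e' : rel T := [rel u v | e v u].
have cs0' : closed_trail e' x0 (rev (belast x0 s0)) by apply: closed_trail_rev cs0.
have V'E : [set v in x0 :: rev (belast x0 s0)] = V.
  by apply/setP=> v; rewrite !in_set mem_rev_belast.
have xls : h xl s by apply: (@free_outside _ e x0 s0) => //; rewrite xlV.
have bx1 : h b x1 by apply: (@free_outside _ e x0 s0) => //; rewrite x1V orbT.
have [S1 [_ S1_gt2 S1_le]] : exists S1 : {set T},
    [/\ ~: ([set v | connect h x1 v] :|: [set v | connect h v x1]) \subset S1,
        2 < #|S1| & 2 * (#|[set v | connect h x1 v]| + #|S1|) <= #|T| + 3].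
  apply: (@reach_bound T e x0 s0 _ _ _ x1 _ _ b s) => //.
  by rewrite inE; apply: connect_trans x1xl (connect1 _).
(* The same bound in the reversed digraph, taken at [xl], with [s] and [b] exchanging roles. *)
have [S2 [S2_sub S2_gt2 S2_le]] : exists S2 : {set T},
    [/\ ~: ([set v | connect h v xl] :|: [set v | connect h xl v]) \subset S2,
        2 < #|S2| & 2 * (#|[set v | connect h v xl]| + #|S2|) <= #|T| + 3].
  have hE u v := @connect_free_rev T e e' (fun _ _ => erefl) x0 s0 lx0 u v.
  have -> : [set v | connect h v xl] =
      [set v | connect (free e' (walk_arcs x0 (rev (belast x0 s0)))) xl v].
    by apply/setP=> v; rewrite !inE hE.
  have -> : [set v | connect h xl v] =
      [set v | connect (free e' (walk_arcs x0 (rev (belast x0 s0)))) v xl].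
    by apply/setP=> v; rewrite !inE hE.
  apply: (@reach_bound T e' x0 _ _ _ _ xl _ _ s b); rewrite ?V'E //.
  - by move=> Q /(@coverable_rev _ e' e (fun _ _ => erefl)) /s0_max.
  - move=> u v /and3P[uv euv evu] dom; rewrite !(@deg_rev _ e e') //.
    apply: deg_large; first by apply/and3P; split.
    by rewrite orbC.
  - by rewrite inE hE; apply: connect_trans (connect1 bx1) x1xl.
set A := [set v | connect h x1 v] in S1_le.
set B := [set v | connect h v xl] in S2_sub S2_le.
have AB_gt0 : 0 < #|A :&: B| by apply/card_gt0P; exists x1; rewrite !inE connect0.
(* Whatever [xl] reaches is reached from [x1], so a vertex outside [A] and [B] is also outside both
   sets of [xl]. *)
have : #|~: (A :|: B)| <= #|S2|.
  apply: subset_leq_card; apply: subset_trans S2_sub.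
  rewrite setCS setUC; apply: setSU; apply/subsetP=> v; rewrite !inE.
  exact: connect_trans.
(* Here |A| + |B| >= n + 1 - |S2|, so the sum of the two bounds yields |S1| <= 2. *)
have := cardsUI A B; have := cardsC (A :|: B).
move: #|~: _| #|A :|: B| #|A :&: B| #|A| #|B| #|S1| #|S2| #|T| AB_gt0 S1_gt2 S1_le S2_gt2 S2_le.
clear; lia.
Qed.

Local Open Scope ring_scope.

Theorem theorem4 (T : finType) (e : rel T)
    (e_loopless : irreflexive e)
    (n_ge2 : (2 <= #|T|)%N)
    (e_strong : strong e)
    (deg_cond : forall u v : T,
       nonadjacent e u v -> dominated e u v || dominating e u v ->
       5%:R / 2%:R * #|T|%:R - 11%:R / 2%:R <= (deg e u + deg e v)%N%:R :> rat) :
  supereulerian e.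
Proof.
apply: supereulerian_deg => // [|u v uv dom]; first exact: ltnW.
have := deg_cond u v uv dom; move: (deg e u + deg e v)%N #|T| => d n le_nd.
rewrite -(ler_nat rat) natrD !natrM.
lra.
Qed.
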